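(* For integers $r\ge1$, $k\ge1$ let $L_r(k)=\#\{n\in\mathbb{N}: f_r\le n<f_{r+1},\ F(n)=k\}$. Then for $r\ge2k$ the number $L_r(k)$ does not depend on $r$. Denoting this common value by $L(k)=\lim_{r\to\infty}L_r(k)$, we have $L(1)=1$ and $L(k)=2\Psi(k)$ for $k>1$.
   Context: $f_0=f_1=1$, $f_i=f_{i-1}+f_{i-2}$ ($i\ge2$). A Fibonacci partition of $n\in\mathbb{N}$ is a finite set $\{f_{i_1},\dots,f_{i_h}\}$ with $1\le i_1<\dots<i_h$ and $f_{i_1}+\dots+f_{i_h}=n$; $F(n)$ is the number of Fibonacci partitions of $n$. The function $\Psi:\mathbb{N}_{\ge1}\to\mathbb{N}$ is defined by $\Psi(1)=1$ and $\Psi(k)=\sum_{1<r\le k,\ r\mid k}\Psi(k/r)\varphi(r)$ for $k\ge2$, with $\varphi$ Euler's totient function (equivalently, $\Psi(k)$ is the number of finite sequences $(a_1/b_1,\dots,a_s/b_s)$ of reduced fractions in $(0,1)$ with $b_1\cdots b_s=k$). *)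

(* Defs.v *)
From mathcomp Require Import all_boot.

Set Implicit Arguments.
Unset Strict Implicit.
Unset Printing Implicit Defensive.

(* Shifted indexing: fib 0 = fib 1 = 1. *)
Fixpoint fib (i : nat) : nat :=
  match i with
  | 0 => 1
  | j.+1 => match j with 0 => 1 | l.+1 => fib j + fib l end
  end.

Lemma fibSS i : fib i.+2 = fib i.+1 + fib i.
Proof. by []. Qed.

Lemma fib_gt0 i : 0 < fib i.
Proof.
suff: (0 < fib i) && (0 < fib i.+1) by case/andP.
by elim: i => // i /andP[h0 h1]; rewrite h1 fibSS addn_gt0 h1.
Qed.

Lemma leq_fib i : i <= fib i.
Proof.
case: i => // i; elim: i => // i IHi; rewrite fibSS.
by rewrite -[i.+2]addn1 leq_add // fib_gt0.
Qed.

(* The bound i <= x on the index loses nothing, see is_fibP. *)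
Definition is_fib (x : nat) : bool :=
  [exists i : 'I_x.+1, (1 <= i) && (fib i == x)].

Lemma is_fibP x : reflect (exists i, 1 <= i /\ fib i = x) (is_fib x).
Proof.
apply: (iffP existsP) => [[i /andP[i1 /eqP fi]]|[i [i1 fi]]]; first by exists i.
have lt_ix : i < x.+1 by rewrite ltnS -fi leq_fib.
by exists (Ordinal lt_ix); rewrite /= i1 fi eqxx.
Qed.

(* A partition is a set of values f_i, i >= 1; every element of a set of
   natural numbers with sum n is at most n, hence the ground type 'I_n.+1. *)
Definition fib_partition (n : nat) (A : {set 'I_n.+1}) : bool :=
  [forall x in A, is_fib x] && (\sum_(x in A) (x : nat) == n).

Definition nb_fib_partitions (n : nat) : nat :=
  #|[set A : {set 'I_n.+1} | fib_partition A]|.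

Definition nb_level (r k : nat) : nat :=
  #|[set n : 'I_(fib r.+1) | (fib r <= n) && (nb_fib_partitions n == k)]|.

(* Psi is defined by recursion on a fuel m >= k; Psi1 and PsiE are its
   defining equations. The value Psi 0 = 0 is irrelevant. *)
Fixpoint Psi_fuel (m k : nat) : nat :=
  if m is m'.+1 then
    if k <= 1 then k
    else \sum_(2 <= r < k.+1 | r %| k) Psi_fuel m' (k %/ r) * totient r
  else 0.

Definition Psi (k : nat) : nat := Psi_fuel k k.

Lemma Psi_fuelE m k : k <= m -> Psi_fuel m k = Psi k.
Proof.
elim/ltn_ind: m k => -[|m] IHm [|k] //.
rewrite /Psi ltnS => le_km /=; case: ifP => // k_gt1.
apply: congr_big_nat => // r /andP[_ /andP[r_gt1 _]].
have lt_dk : k.+1 %/ r <= k by rewrite -ltnS ltn_Pdiv.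
by rewrite IHm ?(leq_trans lt_dk) // IHm.
Qed.

Lemma Psi1 : Psi 1 = 1.
Proof. by []. Qed.

Lemma PsiE k : 2 <= k ->
  Psi k = \sum_(2 <= r < k.+1 | r %| k) Psi (k %/ r) * totient r.
Proof.
case: k => [|k] // k_gt1; rewrite {1}/Psi /= leqNgt k_gt1 /=.
apply: congr_big_nat => // r /andP[_ /andP[r_gt1 _]].
by rewrite Psi_fuelE // -ltnS ltn_Pdiv.
Qed.

(* Main.v *)
Require Import Defs.
From mathcomp Require Import all_boot.
From mathcomp Require Import zify.

(** Write F for the number of Fibonacci partitions. An n with
    f_r <= n < f_(r+1) is f_r + i with i < f_(r-1); give it the state
    (a, s) = (F(i), F(n)), a <= s. Splitting i at f_(r-3) and f_(r-2) expresses
    the number C_r(a, s) of n at level r with state (a, s) by level r - 2: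
      C_r(a, s) = C_(r-2)(a, s - a) + [s = 2a] L_(r-3)(a) + C_(r-2)(2a - s, a).
    This is a subtractive Euclidean algorithm on (a, s), so by induction on s,
    C_r(a, s) = 2 Psi(gcd(a, s)) for 0 < a < s and r >= 2s, while
    C_r(a, a) = [a = 1]. Summing over a and grouping by gcd gives the recursion
    that defines Psi. *)

Set Implicit Arguments.
Unset Strict Implicit.
Unset Printing Implicit Defensive.

(** * Partitions with bounded indices, and their recursion *)

Local Arguments fib : simpl never.

(* The number of partitions of n into distinct f_i with 1 <= i <= r. *)
Fixpoint nb_bounded (r n : nat) : nat :=
  if r is r'.+1 then
    nb_bounded r' n +
    (if fib r <= n then nb_bounded r' (n - fib r) else 0)
  else (n == 0).

Lemma nb_boundedS r n :
  nb_bounded r.+1 n =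
  nb_bounded r n + (if fib r.+1 <= n then nb_bounded r (n - fib r.+1) else 0).
Proof. by []. Qed.

Lemma leq_fibS r : fib r <= fib r.+1.
Proof. by case: r => // r; rewrite fibSS leq_addr. Qed.

Lemma fib_homo : {homo fib : i j / i <= j}.
Proof. exact: (homo_leq leqnn leq_trans leq_fibS). Qed.

Lemma ltn_fibSS r : fib r.+1 < fib r.+2.
Proof. by rewrite fibSS -addn1 leq_add2l fib_gt0. Qed.

(** The ground type ['I_N] is independent of [n] and [r], so that both can vary in the recursion.
    For [is_fib x], the bound [x < fib r.+1] says that the index is at most [r]. *)
Definition bounded_partition r N n (A : {set 'I_N}) : bool :=
  [forall x in A, is_fib x && (x < fib r.+1)] && (\sum_(x in A) (x : nat) == n).

Lemma is_fib_ltSS r x :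
  is_fib x && (x < fib r.+2) = (is_fib x && (x < fib r.+1)) || (x == fib r.+1).
Proof.
apply/idP/idP => [/andP[/[dup] fx /is_fibP[i [i_gt0 <-]] lt_ir]|].
  have le_ir : i <= r.+1.
    by rewrite leqNgt; apply/negP => /fib_homo; rewrite leqNgt lt_ir.
  case: (ltngtP i r.+1) le_ir => // [lt_i _|-> _]; last by rewrite eqxx orbT.
  apply/orP; left; apply/andP; split; first by apply/is_fibP; exists i.
  (* Here [1 <= i] is essential: [fib] is strictly increasing only from index 1 on. *)
  by case: i i_gt0 lt_i {lt_ir fx} => // i _ /fib_homo; apply: leq_trans (ltn_fibSS i).
case/orP=> [/andP[-> /= lt_x]|/eqP->]; first exact: ltn_trans lt_x (ltn_fibSS r).
by rewrite ltn_fibSS andbT; apply/is_fibP; exists r.+1.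
Qed.

Lemma card_bounded_partition0 N n :
  #|[set A : {set 'I_N} | bounded_partition 0 n A]| = (n == 0).
Proof.
have -> : [set A : {set 'I_N} | bounded_partition 0 n A]
        = if n == 0 then [set set0] else set0.
  apply/setP=> A; rewrite inE /bounded_partition.
  have [->|/set0Pn[x xA]] := eqVneq A set0.
    rewrite big_set0 eq_sym.
    have -> : [forall x in (set0 : {set 'I_N}), is_fib x && (x < fib 1)].
      by apply/forall_inP=> x; rewrite inE.
    by case: eqP => _ /=; rewrite !inE ?eqxx.
  have /negPf-> /= : ~~ [forall x in A, is_fib x && (x < fib 1)].
    apply/forall_inPn; exists x => //.
    apply/negP => /andP[/is_fibP[i [_ <-]]].
    by rewrite /= ltnS leqn0 -[_ == 0]negbK -lt0n fib_gt0.
  case: eqP => _; rewrite !inE //.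
  by apply/esym/negbTE/set0Pn; exists x.
by case: eqP => _; rewrite ?cards1 ?cards0.
Qed.

(** Sort the sets by whether they contain f_(r+1); removing it is a bijection onto the partitions of
    the remainder. *)
Lemma card_bounded_partitionS r N n : fib r.+1 < N ->
  #|[set A : {set 'I_N} | bounded_partition r.+1 n A]| =
  #|[set A : {set 'I_N} | bounded_partition r n A]| +
  (if fib r.+1 <= n
   then #|[set A : {set 'I_N} | bounded_partition r (n - fib r.+1) A]| else 0).
Proof.
move=> ltN; pose x0 := Ordinal ltN.
have x0E (x : 'I_N) : (x == fib r.+1 :> nat) = (x == x0) by [].
have notin0 m (A : {set 'I_N}) : bounded_partition r m A -> x0 \notin A.
  case/andP=> /forall_inP hA _; apply/negP => /hA /andP[_].
  by rewrite ltnn.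
rewrite -(cardsID [set A : {set 'I_N} | x0 \in A]) addnC; congr (_ + _).
  apply: eq_card => A; rewrite !inE; apply/andP/idP.
    case=> x0A /andP[/forall_inP hA sA]; apply/andP; split=> //.
    apply/forall_inP=> x xA; have := hA x xA; rewrite is_fib_ltSS x0E.
    by case/orP=> // /eqP xx; rewrite -xx xA in x0A.
  move=> h; split; first exact: notin0 h.
  case/andP: h => /forall_inP hA sA; apply/andP; split=> //.
  by apply/forall_inP=> x /hA; rewrite is_fib_ltSS => ->.
case: leqP => [le_n|lt_n]; last first.
  apply: eq_card0 => A; rewrite !inE; apply/negP => /andP[/andP[_ /eqP sA] x0A].
  by move: lt_n; rewrite -sA (bigD1 x0) //= -addSn; lia.
rewrite -(card_in_imset (f := fun A => x0 |: A)
  (D := [set A : {set 'I_N} | bounded_partition r (n - fib r.+1) A])); last first.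
  move=> A B; rewrite !inE => /notin0 hA /notin0 hB /(congr1 (fun X => X :\ x0)).
  by rewrite !setU1K.
apply: eq_card => A; rewrite !inE; apply/andP/imsetP.
  case=> /andP[/forall_inP hA /eqP sA] x0A.
  exists (A :\ x0); last by rewrite setD1K.
  rewrite inE; apply/andP; split.
    apply/forall_inP=> x; rewrite !inE => /andP[xx0 /hA].
    by rewrite is_fib_ltSS x0E (negPf xx0) orbF.
  move: sA; rewrite (big_setD1 x0) //= => <-; by rewrite addKn.
case=> B; rewrite inE => /[dup] /notin0 x0B /andP[/forall_inP hB /eqP sB] ->.
split; last by rewrite setU11.
apply/andP; split; last by rewrite big_setU1 //= sB subnKC.
apply/forall_inP=> x; rewrite !inE is_fib_ltSS x0E => /orP[->|/hB ->] //.
by rewrite orbT.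
Qed.

Lemma card_bounded_partition r N n : (forall i, i < r -> fib i.+1 < N) ->
  #|[set A : {set 'I_N} | bounded_partition r n A]| = nb_bounded r n.
Proof.
elim: r n => [|r IHr] n ltN; first exact: card_bounded_partition0.
have IH m := IHr m (fun i lt_ir => ltN i (ltnW lt_ir)).
by rewrite card_bounded_partitionS ?ltN // nb_boundedS !IH.
Qed.

Lemma nb_bounded_stable r j n : n < fib r.+1 ->
  nb_bounded (j + r) n = nb_bounded r n.
Proof.
move=> lt_n; elim: j => // j IHj; rewrite addSn nb_boundedS IHj leqNgt.
by rewrite (leq_trans lt_n) ?addn0 //; apply: fib_homo; rewrite ltnS leq_addl.
Qed.

Lemma nb_fib_partitionsE r n : n < fib r.+1 ->
  nb_fib_partitions n = nb_bounded r n.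
Proof.
move=> lt_n; have ex_r : exists i, n < fib i.+1 by exists r.
(* All of f_1, ..., f_r need not fit in ['I_n.+1]. For the least [q] with n < f_(q+1), minimality
   gives f_1, ..., f_q <= n, and stability carries the count from [q] to [r]. *)
case: (ex_minnP ex_r) => q lt_nq min_q.
have le_qr : q <= r by exact: min_q.
rewrite -(subnK le_qr) nb_bounded_stable //.
rewrite -(@card_bounded_partition q n.+1) => [|i lt_iq]; last first.
  by rewrite ltnS leqNgt; apply/negP => /min_q; rewrite leqNgt lt_iq.
apply: eq_card => A; rewrite !inE; congr (_ && _).
apply: eq_forallb_in => x _; rewrite (_ : (x < fib q.+1)) ?andbT //.
exact: leq_ltn_trans (leq_ord x) lt_nq.
Qed.

(** * Recurrences for F, by the gap below the leading Fibonacci number *)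

(** The sum f_1 + ... + f_r equals f_(r+2) - 2, which is less than n. *)
Lemma nb_bounded_large r n : fib r.+2 <= n.+1 -> nb_bounded r n = 0.
Proof.
elim: r n => [|r IHr] n; first by case: n.
rewrite nb_boundedS => le_n; have := fibSS r.+1.
have := fib_gt0 r.+1; have := fib_gt0 r.+2 => h2 h1 e.
by case: ifP => _; rewrite !IHr //; lia.
Qed.

(** A partition either uses f_(q+3), leaving n, or must use f_(q+2), since the smaller parts add up
    to too little; what then remains is f_(q+1) + n. *)
Lemma nb_fib_partitions_addS3 q n : n < fib q.+2 ->
  nb_fib_partitions (fib q.+3 + n) =
  nb_fib_partitions n + nb_bounded q.+1 (fib q.+1 + n).
Proof.
move=> lt_n; have eq3 := fibSS q.+1; have eq4 := fibSS q.+2.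
have [g1 g2] := (fib_gt0 q.+1, fib_gt0 q.+2).
rewrite (@nb_fib_partitionsE q.+3) ?eq4; last by lia.
rewrite nb_boundedS leq_addr addKn (@nb_fib_partitionsE q.+1) //.
rewrite -(@nb_bounded_stable q.+1 1 n) // add1n addnC; congr (_ + _).
rewrite nb_boundedS (@nb_bounded_large q.+1) ?add0n; last by lia.
by rewrite ifT; [congr nb_bounded|]; lia.
Qed.

Lemma nb_fib_partitions_gap4 q n : n < fib q ->
  nb_fib_partitions (fib q.+3 + n) =
  nb_fib_partitions n + nb_fib_partitions (fib q.+1 + n).
Proof.
move=> lt_n; have eq2 := fibSS q.
rewrite nb_fib_partitions_addS3; last by lia.
by rewrite (@nb_fib_partitionsE q.+1 (fib q.+1 + n)) // eq2; lia.
Qed.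

(** The remainder f_(q+1) + n is at least f_(q+2), which exceeds f_1 + ... + f_q. Hence f_(q+1) is
    forced too and n is left again. *)
Lemma nb_fib_partitions_gap3 q n : fib q <= n < fib q.+1 ->
  nb_fib_partitions (fib q.+3 + n) = 2 * nb_fib_partitions n.
Proof.
case/andP=> le_n lt_n; have eq2 := fibSS q.
rewrite nb_fib_partitions_addS3; last by lia.
rewrite nb_boundedS leq_addr addKn nb_bounded_large; last by lia.
by rewrite -(nb_fib_partitionsE lt_n) mul2n -addnn.
Qed.

(** Without f_(q+3), both f_(q+2) and f_(q+1) are forced. This leaves the partitions of f_(q+1) + n
    that avoid f_(q+1), and there are F(f_(q+1) + n) - F(n) of them; the equation is stated
    additively to avoid truncated subtraction. *)
Lemma nb_fib_partitions_gap2 q n : n < fib q ->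
  nb_fib_partitions (fib q.+3 + (fib q.+1 + n)) + nb_fib_partitions n =
  2 * nb_fib_partitions (fib q.+1 + n).
Proof.
move=> lt_n; have [eq2 le_q] := (fibSS q, leq_fibS q).
rewrite nb_fib_partitions_addS3; last by lia.
rewrite mul2n -addnn -addnA; congr (_ + _).
rewrite (@nb_fib_partitionsE q.+1 (fib q.+1 + n)); last by lia.
rewrite !nb_boundedS !leq_addr !addKn nb_bounded_large; last by lia.
by rewrite add0n (@nb_fib_partitionsE q) //; lia.
Qed.

Lemma nb_fib_partitions_gt0 n : 0 < nb_fib_partitions n.
Proof.
have [r] : exists r, n < fib r.+1.
  by exists n; apply: leq_trans (leq_fib n.+1).
move=> lt_n; rewrite (nb_fib_partitionsE lt_n).
elim: r n lt_n => [|r IHr] n lt_n; first by case: n lt_n.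
(* Greedy choice: if f_(r+1) <= n, subtract it; the remainder is below f_r. *)
rewrite nb_boundedS addn_gt0; case: (ltnP n (fib r.+1)) => [/IHr->//|le_n].
have [eq2 le_r] := (fibSS r, leq_fibS r).
by rewrite (IHr (n - _)) ?orbT //; lia.
Qed.

(** Adding f_(q+1) to a partition of n is injective, as n is too small to use it already. *)
Lemma leq_nb_fib_partitions q n : n < fib q ->
  nb_fib_partitions n <= nb_fib_partitions (fib q.+1 + n).
Proof.
move=> lt_n; have [eq2 le_q] := (fibSS q, leq_fibS q).
rewrite (@nb_fib_partitionsE q.+1 (fib q.+1 + n)); last by lia.
by rewrite nb_boundedS leq_addr addKn (@nb_fib_partitionsE q) ?leq_addl //; lia.
Qed.

(** * States and their recursion *)

(* C_r(a, s) at level r = q + 1. *)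
Definition nb_state (q a s : nat) : nat :=
  \sum_(0 <= i < fib q)
    ((nb_fib_partitions i == a) && (nb_fib_partitions (fib q.+1 + i) == s)).

Lemma nb_levelE r k :
  nb_level r k = \sum_(fib r <= i < fib r.+1) (nb_fib_partitions i == k).
Proof.
rewrite /nb_level -sum1_card big_mkcond.
transitivity (\sum_(0 <= i < fib r.+1)
                ((fib r <= i) && (nb_fib_partitions i == k))).
  by rewrite big_mkord; apply: eq_bigr => i _; rewrite inE; case: ifP.
rewrite (@big_cat_nat _ _ _ (fib r)) ?leq_fibS //= big_nat big1 ?add0n.
  by apply: eq_big_nat => i /andP[-> _].
by move=> i /andP[_ lt_i]; rewrite leqNgt lt_i.
Qed.

(** Each n at this level has exactly one state (a, k), and 1 <= a <= k by positivity and
    monotonicity of F. *)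
Lemma nb_levelS q k : nb_level q.+1 k = \sum_(1 <= a < k.+1) nb_state q a k.
Proof.
rewrite nb_levelE exchange_big /= fibSS [_ + fib q]addnC -{1}[fib q.+1]add0n.
rewrite big_addn addnK.
apply: eq_big_nat => i /andP[_ lt_i]; rewrite addnC.
case: eqP => [<-|_]; last by rewrite big1 // => a _; rewrite andbF.
rewrite (bigD1_seq (nb_fib_partitions i)) ?iota_uniq //=; last first.
  by rewrite mem_index_iota nb_fib_partitions_gt0 ltnS leq_nb_fib_partitions.
by rewrite eqxx big1 // => a; rewrite eq_sym andbT => /negPf->.
Qed.

Lemma nb_state_lt q a s : s < a -> nb_state q a s = 0.
Proof.
move=> lt_sa; rewrite /nb_state big_nat big1 // => i /andP[_ /leq_nb_fib_partitions].
by case: eqP => //= ->; case: eqP => //= ->; rewrite leqNgt lt_sa.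
Qed.

Lemma nb_state0 q s : nb_state q 0 s = 0.
Proof.
rewrite /nb_state big1 // => i _.
by rewrite [_ == 0]eqn0Ngt nb_fib_partitions_gt0.
Qed.

(** The three terms come from i < f_q, f_q <= i < f_(q+1) and f_(q+1) <= i < f_(q+2). A truncated
    [s - a] or [2 * a - s] does no harm: it is 0, a value that F never takes. *)
Lemma nb_stateSS q a s :
  nb_state q.+2 a s =
  nb_state q a (s - a) + (s == 2 * a) * nb_level q a + nb_state q (2 * a - s) a.
Proof.
rewrite {1}/nb_state (@big_cat_nat _ _ _ (fib q.+1)) ?leq_fibS //=.
rewrite (@big_cat_nat _ _ _ (fib q)) ?leq_fibS //=; congr (_ + _ + _).
- apply: eq_big_nat => i /andP[_ lt_i]; rewrite nb_fib_partitions_gap4 //.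
  have := nb_fib_partitions_gt0 (fib q.+1 + i).
  by case: eqP => //= ->; lia.
- rewrite nb_levelE big_distrr; apply: eq_big_nat => i lt_i.
  rewrite nb_fib_partitions_gap3 //=.
  by case: eqP => /= [->|_]; rewrite ?muln0 // muln1 eq_sym.
rewrite [X in \sum_(_ <= _ < X) _](_ : _ = fib q + fib q.+1); last by rewrite addnC.
rewrite -{1}[fib q.+1]add0n big_addn addnK; apply: eq_big_nat => i /andP[_ lt_i].
have := nb_fib_partitions_gap2 lt_i; rewrite (addnC i).
have := nb_fib_partitions_gt0 i.
have := nb_fib_partitions_gt0 (fib q.+3 + (fib q.+1 + i)).
by lia.
Qed.

(** The recursion lowers [q] by two, so there are two base cases; both have [fib q] = 1, so only i =
    0 occurs. *)
Lemma nb_state_small q a s : q < 2 -> nb_state q a s = (a == 1) && (s == 1).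
Proof.
have F0 : nb_fib_partitions 0 = 1 by rewrite (@nb_fib_partitionsE 0).
have F1 : nb_fib_partitions 1 = 1 by rewrite (@nb_fib_partitionsE 1).
have F2 : nb_fib_partitions 2 = 1 by rewrite (@nb_fib_partitionsE 2).
by case: q => [|[|]] // _; rewrite /nb_state big_nat1 /= addn0 F0 ?F1 ?F2 !(eq_sym 1).
Qed.

(** For s = a only the third term of the recursion survives, and its state is (a, a) again; so the
    count descends unchanged to a base case. *)
Lemma nb_state_diag q a : 0 < a -> nb_state q a a = (a == 1).
Proof.
move=> a_gt0; elim/ltn_ind: q => -[|[|q]] IHq; try by rewrite nb_state_small // andbb.
rewrite nb_stateSS subnn nb_state_lt // mul2n -addnn addnK IHq //.
by rewrite (_ : (a == a + a) = false) //; lia.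
Qed.

Lemma nb_level1 q : nb_level q.+1 1 = 1.
Proof. by rewrite nb_levelS big_nat1 nb_state_diag. Qed.

(** * Grouping sums over gcds by the totient *)

(** With k = d r, the solutions are a = d b with b < r coprime to r, because gcd(d b, k) = d gcd(b,
    r). *)
Lemma count_gcdn k r : 0 < k -> r %| k ->
  \sum_(0 <= a < k) (k %/ gcdn a k == r) = totient r.
Proof.
move=> k_gt0 /dvdnP[d kE].
have [d_gt0 r_gt0] : 0 < d /\ 0 < r by apply/andP; rewrite -muln_gt0 -kE.
have lt_dk (b : 'I_r) : d * b < k by rewrite kE ltn_pmul2l.
pose f b := Ordinal (lt_dk b).
have f_inj : injective f.
  by move=> b c /(congr1 val) /eqP; rewrite /= eqn_pmul2l // => /eqP /val_inj.
have gcdf b : gcdn (f b) k = d * gcdn b r by rewrite /= kE muln_gcdr.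
rewrite totient_count_coprime !big_mkord.
transitivity #|[set a : 'I_k | k %/ gcdn a k == r]|.
  by rewrite -sum1_card [RHS]big_mkcond; apply: eq_bigr => a _; rewrite inE; case: eqP.
transitivity #|[set b : 'I_r | coprime r b]|; last first.
  by rewrite -sum1_card [LHS]big_mkcond; apply: eq_bigr => a _; rewrite inE; case: coprime.
rewrite -(card_imset _ f_inj); apply: eq_card => a; rewrite inE.
apply/eqP/imsetP => [ra|[b]].
  have gd : gcdn a k = d.
    apply/eqP; rewrite -(eqn_pmul2l r_gt0) (mulnC r d) -kE -{1}ra divnK //.
    exact: dvdn_gcdr.
  have lt_r : a %/ d < r by rewrite ltn_divLR // mulnC -kE.
  have aE : a = f (Ordinal lt_r).
    by apply: val_inj; rewrite /= mulnC divnK // -gd dvdn_gcdl.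
  exists (Ordinal lt_r) => //; rewrite inE coprime_sym.
  by rewrite /coprime -(eqn_pmul2l d_gt0) -gcdf -aE gd muln1.
rewrite inE coprime_sym => /eqP co_b ->.
by rewrite gcdf co_b muln1 kE mulKn.
Qed.

Lemma sum_gcdn (G : nat -> nat) k : 1 < k ->
  \sum_(1 <= a < k) G (gcdn a k) =
  \sum_(2 <= r < k.+1 | r %| k) G (k %/ r) * totient r.
Proof.
move=> k_gt1; have k_gt0 := ltnW k_gt1.
transitivity (\sum_(2 <= r < k.+1 | r %| k)
                \sum_(0 <= a < k) G (gcdn a k) * (k %/ gcdn a k == r)).
  (* The inner sum includes a = 0, where k / gcd(0, k) = 1; this contributes nothing because r >=
     2. *)
  rewrite exchange_big /= [RHS]big_ltn // gcd0n divnn k_gt0.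
  rewrite [X in _ = X + _]big_nat_cond [X in _ = X + _]big1 ?add0n => [|r]; last first.
    by case: r => [|[|r]] //= _; rewrite muln0.
  apply: eq_big_nat => a /andP[a_gt0 lt_ak].
  have g_gt0 : 0 < gcdn a k by rewrite gcdn_gt0 a_gt0.
  have lt_gk : gcdn a k < k by apply: leq_ltn_trans lt_ak; rewrite dvdn_leq ?dvdn_gcdl.
  rewrite -big_filter (bigD1_seq (k %/ gcdn a k)) ?filter_uniq ?iota_uniq //=.
    by rewrite eqxx muln1 big1 ?addn0 // => r; rewrite eq_sym => /negPf->; rewrite muln0.
  rewrite mem_filter mem_index_iota ltnS leq_div andbT.
  have -> /= : k %/ gcdn a k %| k.
    by apply/dvdnP; exists (gcdn a k); rewrite mulnC divnK ?dvdn_gcdr.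
  by rewrite ltn_divRL ?dvdn_gcdr // mul1n.
rewrite big_nat_cond [RHS]big_nat_cond.
apply: eq_bigr => r /andP[_ r_k].
rewrite -(count_gcdn k_gt0 r_k) big_distrr; apply: eq_bigr => a _ /=.
case: eqP => [<-|]; last by rewrite !muln0.
by rewrite -{2}(divnK (dvdn_gcdr a k)) mulKn // divn_gt0 ?gcdn_gt0 ?k_gt0 ?orbT //
  dvdn_leq ?dvdn_gcdr.
Qed.

(** * The Euclidean induction and the limit values *)

(** Conditional on the state counts, so that it also serves inside the induction that proves
    them. *)
Lemma nb_level_Psi q k : 1 < k ->
  (forall a, 0 < a < k -> nb_state q a k = 2 * Psi (gcdn a k)) ->
  nb_level q.+1 k = 2 * Psi k.
Proof.
move=> k_gt1 stateE; have k_gt0 := ltnW k_gt1.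
rewrite nb_levelS big_nat_recr //= nb_state_diag // (gtn_eqF k_gt1) addn0.
rewrite PsiE // -(sum_gcdn _ k_gt1) big_distrr.
by apply: eq_big_nat => a lt_a; rewrite stateE.
Qed.

(** Each step lowers [q] by two and [s] by at least one, which preserves [2 * s <= q.+1], while the
    gcd is invariant. *)
Lemma nb_stateE q a s : 0 < a < s -> 2 * s <= q.+1 ->
  nb_state q a s = 2 * Psi (gcdn a s).
Proof.
elim/ltn_ind: s q a => s IHs q a /andP[a_gt0 lt_as] le_sq.
have level_a r : 1 < a -> 2 * a <= r.+1 -> nb_level r.+1 a = 2 * Psi a.
  by move=> a_gt1 le_ar; apply: nb_level_Psi => // b lt_b; rewrite IHs.
case: q le_sq => [|[|q]] le_sq; try lia.
rewrite nb_stateSS; case: (ltngtP s (2 * a)) => [lt_s2|gt_s2|eq_s2].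
- rewrite nb_state_lt; last by lia.
  rewrite IHs //; try lia.
  rewrite !add0n; congr (2 * Psi _).
  (* Take t = 2a - s and u = s - a, so that t + u = a and u + (t + u) = s. *)
  have gcdE t u : gcdn t (t + u) = gcdn (t + u) (u + (t + u)).
    by rewrite gcdnDl gcdnDr [RHS]gcdnC gcdnDr gcdnC.
  have := gcdE (2 * a - s) (s - a).
  rewrite (_ : 2 * a - s + (s - a) = a); last by lia.
  by rewrite subnK // ltnW.
- rewrite (_ : 2 * a - s = 0) ?nb_state0 ?addn0; last by lia.
  rewrite IHs //; try lia.
  congr (2 * Psi _); by rewrite -{2}(subnK (ltnW lt_as)) gcdnDr.
(* The Euclidean algorithm stops at s = 2a, with gcd a. The total is [a = 1] + L_q(a): for a > 1 the
   level gives 2 Psi(a), and for a = 1 it is 1 + 1 = 2 Psi(1). *)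
rewrite eq_s2 subnn nb_state0 mul1n addn0 gcdnMl mul2n -addnn addnK nb_state_diag //.
case: (ltngtP a 1) => [|a_gt1|a1]; first by lia.
- case: q le_sq => [|q] le_sq; first by lia.
  by rewrite level_a //; lia.
case: q le_sq => [|q] le_sq; first by lia.
by rewrite a1 nb_level1.
Qed.

Theorem theorem4p4 :
  exists L : nat -> nat,
    [/\ forall k r : nat, 1 <= k -> 2 * k <= r -> nb_level r k = L k,
        L 1 = 1
      & forall k : nat, 1 < k -> L k = 2 * Psi k].
Proof.
(* The value at 1 is separate: there only the diagonal state (1, 1) occurs, counted once, whereas 2
   Psi(1) = 2. *)
exists (fun k => if k == 1 then 1 else 2 * Psi k); split=> // [k [|r] k_gt0 le_kr|k k_gt1].
- by lia.
- case: eqP => [->|/eqP k_neq1]; first exact: nb_level1.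
  by apply: nb_level_Psi => [|a lt_a]; [lia | rewrite nb_stateE].
by rewrite gtn_eqF.
Qed.
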